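(* Let $k$ be a field of characteristic zero and let $(\mathcal{H}_c,\mathcal{H}_o,\mathcal{D})$ be an OCHA over $k$, with $\mathcal{D}$ given by structure maps $\{l_n\}_{n\ge1}$, $\{n_{p,q}\}_{p+q\ge1}$. The universal enveloping $A_\infty$-algebra $\mathcal{U}_\infty(\mathcal{H}_c,\mathcal{H}_o)$ is an $A_\infty$-extension of $\mathcal{U}_\infty(\mathcal{H}_c)$ by $\langle\mathcal{H}_o\rangle$: $$0\to\langle\mathcal{H}_o\rangle\to\mathcal{U}_\infty(\mathcal{H}_c,\mathcal{H}_o)\to\mathcal{U}_\infty(\mathcal{H}_c)\to0,$$ where $\langle\mathcal{H}_o\rangle$ is the $A_\infty$-ideal of $\mathcal{U}_\infty(\mathcal{H}_c,\mathcal{H}_o)$ generated by (the image of) $\mathcal{H}_o$.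
   Context: All vector spaces are $\mathbb{Z}$-graded over $k$. Koszul convention: $(f \otimes g)(x \otimes y) = (-1)^{|g||x|} f(x)\otimes g(y)$. In exponents of $-1$ an element stands for its degree. For $\sigma \in S_n$, $(-1)^{\epsilon(\sigma)}$ is the Koszul sign of $x_1\otimes\cdots\otimes x_n \mapsto (-1)^{\epsilon(\sigma)}x_{\sigma(1)}\otimes\cdots\otimes x_{\sigma(n)}$. $\mathfrak{S}_{a,b}$ is the set of $(a,b)$-unshuffles: $\sigma\in S_{a+b}$ with $\sigma(1)<\cdots<\sigma(a)$ and $\sigma(a+1)<\cdots<\sigma(a+b)$. $L_\infty$-algebra: a graded vector space $V$ with degree one graded symmetric maps $l_n:V^{\otimes n}\to V$ ($n\ge1$) such that for all $n\ge1$ $$\sum_{k+l=n,\,k\ge1,\,l\geq 0}\ \sum_{\sigma\in\mathfrak{S}_{k,l}}(-1)^{\epsilon(\sigma)}\,l_{l+1}(l_k(v_{\sigma(1)},\dots,v_{\sigma(k)}),v_{\sigma(k+1)},\dots,v_{\sigma(n)})=0.$$ OCHA structure on $(\mathcal{H}_c,\mathcal{H}_o)$: degree one maps $l_n:\mathcal{H}_c^{\wedge n}\to\mathcal{H}_c$ ($n\ge1$) and $n_{p,q}:\mathcal{H}_c^{\wedge p}\otimes\mathcal{H}_o^{\otimes q}\to\mathcal{H}_o$ ($p+q\ge1$) such that $(\mathcal{H}_c,\{l_n\})$ is an $L_\infty$-algebra and for all $n,m\ge0$ with $n+m\geq 1$, $v_i\in\mathcal{H}_c$, $a_j\in\mathcal{H}_o$: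 $$\sum_{p+r=n,\,p\ge1}\sum_{\sigma\in\mathfrak{S}_{p,r}}(-1)^{\epsilon(\sigma)}n_{1+r,m}(l_p(v_{\sigma(1)},\dots,v_{\sigma(p)}),v_{\sigma(p+1)},\dots,v_{\sigma(n)},a_1,\dots,a_m)$$ $$+\sum_{p+r=n}\ \sum_{\sigma\in\mathfrak{S}_{p,r}}\ \sum_{i+s+j=m,\ r+s\ge1}(-1)^{\mu_{p,i}(\sigma)}n_{p,i+1+j}(v_{\sigma(1)},\dots,v_{\sigma(p)},a_1,\dots,a_i,n_{r,s}(v_{\sigma(p+1)},\dots,v_{\sigma(n)},a_{i+1},\dots,a_{i+s}),a_{i+s+1},\dots,a_m)=0,$$ where $\mu_{p,i}(\sigma)=\epsilon(\sigma)+(v_{\sigma(1)}+\cdots+v_{\sigma(p)})+(a_1+\cdots+a_i)+(a_1+\cdots+a_i)(v_{\sigma(p+1)}+\cdots+v_{\sigma(n)})$. $A_\infty$-algebra: a graded vector space $V$ with degree one maps $m_n:V^{\otimes n}\to V$ ($n\ge1$) such that for all $n\geq 1$, $\sum_{i+s+j=n,\,s\ge1}m_{i+1+j}(1^{\otimes i}\otimes m_s\otimes1^{\otimes j})=0$. A linear $A_\infty$-morphism $(V,\{m_n\})\to(W,\{m'_n\})$ is a degree zero linear map $f$ with $f\circ m_n=m'_n\circ f^{\otimes n}$ for all $n\ge1$. An $A_\infty$-ideal of $V$ is a graded subspace $I\subseteq V$ with $m_n(x_1,\dots,x_n)\in I$ whenever some $x_i\in I$; the $A_\infty$-ideal generated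 by a set is the smallest one containing it; $V/I$ inherits an $A_\infty$-structure. An $A_\infty$-extension of $B$ by $A$ is an $A_\infty$-algebra $E$ with a short exact sequence $0\to A\to E\to B\to0$ of linear $A_\infty$-morphisms. $\mathcal{F}_\infty(V)$ is the free $A_\infty$-algebra generated by the graded vector space $V$: every degree zero linear map from $V$ to an $A_\infty$-algebra extends uniquely to a linear $A_\infty$-morphism from $\mathcal{F}_\infty(V)$. Its structure maps are denoted $\mu_n$. Shuffle product: $Sh(a_1,\dots,a_i\,|\,a_{i+1},\dots,a_n)=\sum_\sigma(-1)^{\epsilon(\sigma)}a_{\sigma(1)}\otimes\cdots\otimes a_{\sigma(n)}$, over $\sigma\in S_n$ with $\sigma^{-1}(1)<\cdots<\sigma^{-1}(i)$ and $\sigma^{-1}(i+1)<\cdots<\sigma^{-1}(n)$. $\mathcal{U}_\infty(\mathcal{H}_c,\mathcal{H}_o)$ is the quotient of $\mathcal{F}_\infty(\mathcal{H}_c\oplus\mathcal{H}_o)$ by the $A_\infty$-ideal generated by the relations, for $c_i\in\mathcal{H}_c$, $o_j\in\mathcal{H}_o$, $$\sum_{\sigma\in S_p}(-1)^{\epsilon(\sigma)}\mu_{p+q}(Sh(c_{\sigma(1)},\dots,c_{\sigma(p)}\,|\,o_1,\dots,o_q))=n_{p,q}(c_1,\dots,c_p,o_1,\dots,o_q)\quad(p\ge0,\ q\ge1),$$ $$\sum_{\sigma\in S_p}(-1)^{\epsilon(\sigma)}\mu_p(c_{\sigma(1)},\dots,c_{\sigma(p)})=l_p(c_1,\dots,c_p)+n_{p,0}(c_1,\dots,c_p)\quad(p\ge1).$$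 $\mathcal{U}_\infty(\mathcal{H}_c)$ is the Lada-Markl universal enveloping $A_\infty$-algebra of the $L_\infty$-algebra $(\mathcal{H}_c,\{l_n\})$: the quotient of $\mathcal{F}_\infty(\mathcal{H}_c)$ by the $A_\infty$-ideal generated by the relations $\sum_{\sigma\in S_p}(-1)^{\epsilon(\sigma)}\mu_p(c_{\sigma(1)},\dots,c_{\sigma(p)})=l_p(c_1,\dots,c_p)$ for $p\ge1$, $c_i\in\mathcal{H}_c$ (equivalently, $\mathcal{U}_\infty(\mathcal{H}_c)=\mathcal{U}_\infty(\mathcal{H}_c,0)$, the universal enveloping $A_\infty$-algebra of the OCHA on the pair $(\mathcal{H}_c,0)$ with structure maps $\{l_n\}$ and all $n_{p,q}=0$). *)

(* Defs.v *)
From Stdlib Require List.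
From HB Require Import structures.
From mathcomp Require Import all_boot all_order all_fingroup all_algebra.
From mathcomp Require Import boolp.

Set Implicit Arguments.
Unset Strict Implicit.
Unset Printing Implicit Defensive.

Import Order.TTheory GRing.Theory Num.Theory.
Local Open Scope ring_scope.
Local Open Scope quotient_scope.

(* A family of maps f_n : V^{(x) n} -> W, n >= 1, is a single map            *)
(* f : seq V -> W, with f_n the restriction of f to sequences of length n;   *)
(* as there is no f_0, f [::] is normalised to 0, and likewise for n_{0,0}.  *)
(* Formulas with Koszul signs are stated on homogeneous arguments, whose     *)
(* degrees are carried along as a sequence or tuple of integers; by          *)
(* multilinearity this determines the maps.  Permutations and positions are  *)
(* counted from 0.                                                           *)

(* gvs_car is the direct sum of the homogeneous parts {x | hom d x}. *)
Record gvs (k : fieldType) := Gvs {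
  gvs_car :> lmodType k;
  hom : int -> gvs_car -> Prop;
  hom0 : forall d, hom d 0;
  homP : forall d a x y, hom d x -> hom d y -> hom d (a *: x + y);
  hom_span : forall x, exists (D : seq int) (y : int -> gvs_car),
    [/\ uniq D, forall d, hom d (y d) & x = \sum_(d <- D) y d];
  hom_indep : forall (D : seq int) (y : int -> gvs_car),
    uniq D -> (forall d, hom d (y d)) -> \sum_(d <- D) y d = 0 ->
    forall d, d \in D -> y d = 0
}.
Arguments hom {k} g d x.

Section MultilinearMaps.
Variable k : fieldType.

Definition multilinear (V W : lmodType k) (f : seq V -> W) : Prop :=
  forall s t a x y,
    f (s ++ (a *: x + y) :: t) = a *: f (s ++ x :: t) + f (s ++ y :: t).

Definition homs (V : gvs k) (ds : seq int) (xs : seq V) : Prop :=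
  List.Forall2 (fun d x => hom V d x) ds xs.

Definition tdeg (ds : seq int) : int := \sum_(d <- ds) d.

Definition degree_one (V W : gvs k) (f : seq V -> W) : Prop :=
  forall ds xs, homs ds xs -> hom W (tdeg ds + 1) (f xs).

Definition degree_zero (V W : gvs k) (f : V -> W) : Prop :=
  forall d x, hom V d x -> hom W d (f x).

Definition ptup (T : Type) n (s : 'S_n) (x : n.-tuple T) : n.-tuple T :=
  [tuple tnth x (s i) | i < n].

(* The exponent epsilon(s) for homogeneous elements of degrees d: every pair *)
(* that s puts out of order contributes the product of its degrees.          *)
Definition koszul n (s : 'S_n) (d : n.-tuple int) : int :=
  \sum_(i < n) \sum_(j < n | (i < j)%N && (s j < s i)%N)
     tnth d (s i) * tnth d (s j).

Definition graded_symmetric (V W : gvs k) (f : seq V -> W) : Prop :=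
  forall n (s : 'S_n) (d : n.-tuple int) (x : n.-tuple V), homs d x ->
    (-1) ^ koszul s d *: f (ptup s x) = f x.

(* s is increasing on positions < p and on positions >= p. *)
Definition unshuffle p n (s : 'S_n) : bool :=
  [forall i : 'I_n, forall j : 'I_n,
     (i < j)%N && ((j < p)%N || (p <= i)%N) ==> (s i < s j)%N].

End MultilinearMaps.

Definition Linf_relation (k : fieldType) (V : gvs k) (l : seq V -> V) : Prop :=
  forall n (d : n.-tuple int) (v : n.-tuple V), (0 < n)%N -> homs d v ->
  \sum_(p < n.+1 | (0 < p)%N) \sum_(s : 'S_n | unshuffle p s)
     (-1) ^ koszul s d *: l (l (take p (ptup s v)) :: drop p (ptup s v)) = 0.

Record Linf (k : fieldType) := MkLinf {
  Linf_gvs :> gvs k;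
  lop : seq Linf_gvs -> Linf_gvs;
  lop_nil : lop [::] = 0;
  lop_multilinear : multilinear lop;
  lop_degree : degree_one lop;
  lop_symmetric : graded_symmetric lop;
  lop_relation : Linf_relation lop
}.
Arguments lop {k l} _.

(* In the second sum r = n - p and the letter t stands for the arity s of    *)
(* the inner open argument block.                                            *)
Definition ocha_relation (k : fieldType) (Hc : Linf k) (Ho : gvs k)
    (n_ : seq Hc -> seq Ho -> Ho) : Prop :=
  forall n m (d : n.-tuple int) (v : n.-tuple Hc)
         (e : m.-tuple int) (a : m.-tuple Ho),
  (0 < n + m)%N -> homs d v -> homs e a ->
  \sum_(p < n.+1 | (0 < p)%N) \sum_(s : 'S_n | unshuffle p s)
     (-1) ^ koszul s d *:
       n_ (lop (take p (ptup s v)) :: drop p (ptup s v)) a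
  + \sum_(p < n.+1) \sum_(s : 'S_n | unshuffle p s)
    \sum_(i < m.+1) \sum_(t < m.+1 | (i + t <= m)%N && (0 < (n - p) + t)%N)
     (-1) ^ (koszul s d + tdeg (take p (ptup s d)) + tdeg (take i e)
             + tdeg (take i e) * tdeg (drop p (ptup s d))) *:
       n_ (take p (ptup s v))
          (take i a
           ++ n_ (drop p (ptup s v)) (take t (drop i a)) :: drop (i + t) a)
  = 0.

Record ocha (k : fieldType) := Ocha {
  ocha_closed : Linf k;
  ocha_open : gvs k;
  nop : seq ocha_closed -> seq ocha_open -> ocha_open;
  nop_nil : nop [::] [::] = 0;
  nop_multilinear_closed : forall a, multilinear (fun v => nop v a);
  nop_multilinear_open : forall v, multilinear (nop v);
  nop_degree : forall d v e a, homs d v -> homs e a ->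
    hom ocha_open (tdeg d + tdeg e + 1) (nop v a);
  nop_symmetric : forall a, graded_symmetric (fun v => nop v a);
  nop_relation : ocha_relation nop
}.
Arguments nop {k o} _ _.

Definition Ainf_relation (k : fieldType) (V : gvs k) (m : seq V -> V) : Prop :=
  forall n (d : n.-tuple int) (x : n.-tuple V), (0 < n)%N -> homs d x ->
  \sum_(i < n.+1) \sum_(s < n.+1 | (i + s <= n)%N && (0 < s)%N)
     (-1) ^ tdeg (take i d) *:
       m (take i x ++ m (take s (drop i x)) :: drop (i + s) x) = 0.

Record Ainf (k : fieldType) := MkAinf {
  Ainf_gvs :> gvs k;
  mop : seq Ainf_gvs -> Ainf_gvs;
  mop_nil : mop [::] = 0;
  mop_multilinear : multilinear mop;
  mop_degree : degree_one mop;
  mop_relation : Ainf_relation mop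
}.
Arguments mop {k a} _.

Section AinfTheory.
Variable k : fieldType.

Record Ainf_morphism (A B : Ainf k) (f : A -> B) : Prop := {
  Ainf_morphism_linear : linear f;
  Ainf_morphism_degree : degree_zero f;
  Ainf_morphism_mop : forall xs, f (mop xs) = mop (map f xs)
}.

Record short_exact (A E B : Ainf k) (f : A -> E) (g : E -> B) : Prop := {
  short_exact_left : Ainf_morphism f;
  short_exact_right : Ainf_morphism g;
  short_exact_inj : injective f;
  short_exact_mid : forall x, g x = 0 <-> exists y, f y = x;
  short_exact_surj : forall z, exists x, g x = z
}.

(* A subspace is graded when it contains the homogeneous components of each  *)
(* of its elements.                                                          *)
Record Ainf_ideal (A : Ainf k) := MkIdeal {
  ideal_set :> A -> Prop;
  ideal0 : ideal_set 0;
  idealP : forall a x y, ideal_set x -> ideal_set y -> ideal_set (a *: x + y);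
  ideal_graded : forall (D : seq int) (y : int -> A),
    uniq D -> (forall d, hom A d (y d)) -> ideal_set (\sum_(d <- D) y d) ->
    forall d, d \in D -> ideal_set (y d);
  ideal_mop : forall s x t, ideal_set x -> ideal_set (mop (s ++ x :: t))
}.

Section Multilinear.
Variables (V W : lmodType k) (f : seq V -> W).
Hypothesis fML : multilinear f.

Lemma multilinear0 s t : f (s ++ 0 :: t) = 0.
Proof.
have := fML s t (-1) 0 0.
by rewrite scaler0 addr0 scaleN1r addNr.
Qed.

Lemma multilinearD s t x y :
  f (s ++ (x + y) :: t) = f (s ++ x :: t) + f (s ++ y :: t).
Proof. by have := fML s t 1 x y; rewrite !scale1r. Qed.

Lemma multilinearZ s t a x : f (s ++ (a *: x) :: t) = a *: f (s ++ x :: t).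
Proof. by have := fML s t a x 0; rewrite multilinear0 !addr0. Qed.

Lemma multilinearB s t x y :
  f (s ++ (x - y) :: t) = f (s ++ x :: t) - f (s ++ y :: t).
Proof. by rewrite -scaleN1r addrC fML scaleN1r addrC. Qed.
End Multilinear.

Lemma span_pairs (V : lmodType k) (h : int -> V -> Prop) :
  (forall d, h d 0) ->
  (forall d a x y, h d x -> h d y -> h d (a *: x + y)) ->
  forall (L : seq (int * V)), List.Forall (fun p => h p.1 p.2) L ->
  exists (D : seq int) (y : int -> V),
    [/\ uniq D, forall d, h d (y d) & \sum_(p <- L) p.2 = \sum_(d <- D) y d].
Proof.
move=> h0 hP L HL.
exists (undup (map fst L)), (fun d => \sum_(p <- L | p.1 == d) p.2).
split; first exact: undup_uniq.
  move=> d; elim: HL => [|p L' hp _ IH]; first by rewrite big_nil.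
  rewrite big_cons; case: ifP => // /eqP pd.
  by rewrite -[p.2]scale1r; apply: hP => //; rewrite -pd.
rewrite (exchange_big_dep predT) //= big_seq [RHS]big_seq.
apply: eq_bigr => p pL.
rewrite big_mkcond (bigD1_seq p.1) ?undup_uniq ?mem_undup ?map_f //= eqxx.
by rewrite big1 ?addr0 // => i; rewrite eq_sym => /negPf ->.
Qed.

Lemma hom_sum (V : gvs k) (I : Type) (r : seq I) (P : pred I) d (F : I -> V) :
  (forall i, P i -> hom V d (F i)) -> hom V d (\sum_(i <- r | P i) F i).
Proof.
move=> h; elim/big_ind: _ => // [|x y hx hy]; first exact: hom0.
by rewrite -[x]scale1r; apply: homP.
Qed.

End AinfTheory.

Section IdealAinf.
Variables (k : fieldType) (A : Ainf k) (I : Ainf_ideal A).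

Definition ideal_pred : {pred A} := fun x => `[< I x >].

Fact ideal_submod_closed : submod_closed ideal_pred.
Proof.
split=> [|a x y]; first by apply/asboolP/ideal0.
by move=> /asboolP hx /asboolP hy; apply/asboolP/idealP.
Qed.
HB.instance Definition _ :=
  GRing.isSubmodClosed.Build k A ideal_pred ideal_submod_closed.

Definition ideal_car := {x : A | x \in ideal_pred}.
HB.instance Definition _ := SubChoice.on ideal_car.
HB.instance Definition _ := [SubChoice_isSubLmodule of ideal_car by <:].

Definition incl (x : ideal_car) : A := val x.

Fact incl_linear : linear incl.
Proof. by []. Qed.

Fact incl_ideal x : I (incl x).
Proof. exact/asboolP/(valP x). Qed.

Definition ideal_hom d (x : ideal_car) : Prop := hom A d (incl x).

Fact ideal_mop_subproof (xs : seq ideal_car) : mop (map incl xs) \in ideal_pred.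
Proof.
apply/asboolP; case: xs => [|x xs] /=; first by rewrite mop_nil; exact: ideal0.
exact: (@ideal_mop _ _ I [::]) (incl_ideal x).
Qed.

Definition ideal_op (xs : seq ideal_car) : ideal_car :=
  Sub (mop (map incl xs)) (ideal_mop_subproof xs).

Fact ideal_hom0 d : ideal_hom d 0.
Proof. exact: hom0. Qed.

Fact ideal_homP d a x y :
  ideal_hom d x -> ideal_hom d y -> ideal_hom d (a *: x + y).
Proof. exact: homP. Qed.

Fact incl_sum (J : Type) (r : seq J) (P : pred J) (F : J -> ideal_car) :
  incl (\sum_(i <- r | P i) F i) = \sum_(i <- r | P i) incl (F i).
Proof. by apply: (big_morph incl). Qed.

Fact ideal_span (x : ideal_car) : exists (D : seq int) (y : int -> ideal_car),
  [/\ uniq D, forall d, ideal_hom d (y d) & x = \sum_(d <- D) y d].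
Proof.
have [D [y [uD hy xE]]] := hom_span (incl x).
have Iy d : d \in D -> y d \in ideal_pred.
  move=> dD; apply/asboolP; apply: (@ideal_graded _ _ I D y) => //.
  by rewrite -xE; exact: incl_ideal.
pose z d : ideal_car := insubd 0 (y d).
exists D, z; split=> // [d|].
  by rewrite /ideal_hom /incl /z val_insubd; case: ifP => // _; exact: hom0.
apply: val_inj; rewrite -[LHS]/(incl x) -[RHS]/(incl _) incl_sum xE.
by apply: eq_big_seq => d dD; rewrite /incl /z val_insubd Iy.
Qed.

Fact ideal_indep (D : seq int) (y : int -> ideal_car) :
  uniq D -> (forall d, ideal_hom d (y d)) -> \sum_(d <- D) y d = 0 ->
  forall d, d \in D -> y d = 0.
Proof.
move=> uD hy /(congr1 incl); rewrite incl_sum => y0 d dD.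
by apply: val_inj; exact: (@hom_indep _ A D (fun d => incl (y d))).
Qed.

Definition ideal_gvs : gvs k :=
  Gvs ideal_hom0 ideal_homP ideal_span ideal_indep.

Fact ideal_op_nil : ideal_op [::] = 0 :> ideal_gvs.
Proof. by apply: val_inj; rewrite /= mop_nil. Qed.

Fact ideal_op_multilinear : @multilinear k ideal_gvs ideal_gvs ideal_op.
Proof.
move=> s t a x y; apply: val_inj; rewrite /= !map_cat /=.
exact: mop_multilinear.
Qed.

Fact homs_incl ds (xs : seq ideal_gvs) : homs ds xs -> homs ds (map incl xs).
Proof. by elim=> [|d x ds' xs' hx _ IH]; constructor. Qed.

Fact ideal_op_degree : @degree_one k ideal_gvs ideal_gvs ideal_op.
Proof. by move=> ds xs /homs_incl; exact: mop_degree. Qed.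

Fact ideal_op_relation : @Ainf_relation k ideal_gvs ideal_op.
Proof.
move=> n d x n0 hx.
have := @mop_relation _ A n d (map_tuple incl x) n0 (homs_incl hx).
move=> rel; apply: val_inj; rewrite -[LHS]/(incl _) -[RHS]rel incl_sum.
apply: eq_bigr => i _; rewrite incl_sum; apply: eq_bigr => j _.
by rewrite /ideal_op /incl /= map_cat /= !map_take !map_drop.
Qed.

Definition ideal_Ainf : Ainf k :=
  MkAinf ideal_op_nil ideal_op_multilinear ideal_op_degree ideal_op_relation.

End IdealAinf.

Section IdealGen.
Variables (k : fieldType) (A : Ainf k) (S : A -> Prop).

Definition gen_set (x : A) : Prop :=
  forall I : Ainf_ideal A, (forall y, S y -> I y) -> I x.

Fact gen_set0 : gen_set 0.
Proof. by move=> I _; exact: ideal0. Qed.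

Fact gen_setP a x y : gen_set x -> gen_set y -> gen_set (a *: x + y).
Proof. by move=> hx hy I SI; apply: idealP; [exact: hx|exact: hy]. Qed.

Fact gen_set_graded (D : seq int) (y : int -> A) :
  uniq D -> (forall d, hom A d (y d)) -> gen_set (\sum_(d <- D) y d) ->
  forall d, d \in D -> gen_set (y d).
Proof.
move=> uD hy h d dD I SI; apply: (@ideal_graded _ _ I D y) => //; exact: h.
Qed.

Fact gen_set_mop s x t : gen_set x -> gen_set (mop (s ++ x :: t)).
Proof. by move=> h I SI; apply: ideal_mop; exact: h. Qed.

Definition ideal_gen : Ainf_ideal A :=
  MkIdeal gen_set0 gen_setP gen_set_graded gen_set_mop.

End IdealGen.

Section QuotAinf.
Variables (k : fieldType) (A : Ainf k) (I : Ainf_ideal A).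

Definition quot_car := Quotient.quot (ideal_pred I).
HB.instance Definition _ := GRing.Zmodule.on quot_car.

Definition proj (x : A) : quot_car := \pi_quot_car x.
Definition qlift (q : quot_car) : A := generic_quotient.repr q.

Fact qliftK : cancel qlift proj.
Proof. exact: reprK. Qed.

Fact projP x y : proj x = proj y <-> I (x - y).
Proof.
split=> [/eqP|h]; first by rewrite /proj -Quotient.idealrBE => /asboolP.
by apply/eqP; rewrite /proj -Quotient.idealrBE; apply/asboolP.
Qed.

Fact projD x y : proj (x + y) = proj x + proj y.
Proof. by rewrite /proj !piE. Qed.

Definition quot_scale (a : k) (q : quot_car) : quot_car := proj (a *: qlift q).

Fact projZ a x : proj (a *: x) = quot_scale a (proj x).
Proof.
apply/projP; rewrite -scalerBr -[a *: _]addr0; apply: idealP; last exact: ideal0.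
by apply/projP; rewrite qliftK.
Qed.

Fact quot_scaleA a b q : quot_scale a (quot_scale b q) = quot_scale (a * b) q.
Proof. by rewrite -[q]qliftK -!projZ scalerA. Qed.

Fact quot_scale1 : left_id 1 quot_scale.
Proof. by move=> q; rewrite -[q]qliftK -projZ scale1r. Qed.

Fact quot_scaleDr : right_distributive quot_scale +%R.
Proof.
by move=> a p q; rewrite -[p]qliftK -[q]qliftK -projD -!projZ -projD scalerDr.
Qed.

Fact quot_scaleDl q : {morph quot_scale^~ q : a b / a + b}.
Proof. by move=> a b; rewrite -[q]qliftK -!projZ -projD scalerDl. Qed.

HB.instance Definition _ := GRing.Zmodule_isLmodule.Build k quot_car
  quot_scaleA quot_scale1 quot_scaleDr quot_scaleDl.

Fact proj_linear : linear proj.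
Proof. by move=> a x y; rewrite projD projZ. Qed.

Fact proj0 : proj 0 = 0.
Proof. by have := projD 0 0; rewrite addr0 -{1}[proj 0]addr0 => /addrI. Qed.

Fact proj_eq0 x : proj x = 0 <-> I x.
Proof. by rewrite -proj0 projP subr0. Qed.

Fact proj_sum (J : Type) (r : seq J) (P : pred J) (F : J -> A) :
  proj (\sum_(i <- r | P i) F i) = \sum_(i <- r | P i) proj (F i).
Proof. exact: (big_morph proj projD proj0). Qed.

Definition quot_hom d (q : quot_car) : Prop := exists2 x, hom A d x & proj x = q.

Fact quot_hom0 d : quot_hom d 0.
Proof. by exists 0; [exact: hom0 | exact: proj0]. Qed.

Fact quot_homP d a p q :
  quot_hom d p -> quot_hom d q -> quot_hom d (a *: p + q).
Proof.
move=> [x hx <-] [y hy <-]; exists (a *: x + y); last exact: proj_linear.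
exact: homP.
Qed.

Fact quot_span (q : quot_car) : exists (D : seq int) (y : int -> quot_car),
  [/\ uniq D, forall d, quot_hom d (y d) & q = \sum_(d <- D) y d].
Proof.
have [D [y [uD hy qE]]] := hom_span (qlift q).
exists D, (fun d => proj (y d)); split=> // [d|]; first by exists (y d).
by rewrite -proj_sum -qE qliftK.
Qed.

Fact quot_indep (D : seq int) (y : int -> quot_car) :
  uniq D -> (forall d, quot_hom d (y d)) -> \sum_(d <- D) y d = 0 ->
  forall d, d \in D -> y d = 0.
Proof.
move=> uD hy; have /choice[z zP] : forall d, exists x, hom A d x /\ proj x = y d.
  by move=> d; have [x hx xy] := hy d; exists x.
rewrite (eq_bigr (fun d => proj (z d))); last by move=> d _; case: (zP d).
rewrite -proj_sum => /proj_eq0 Iz d dD; have [_ <-] := zP d.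
by apply/proj_eq0; apply: (@ideal_graded _ _ I D z) => // e; case: (zP e).
Qed.

Definition quot_gvs : gvs k := Gvs quot_hom0 quot_homP quot_span quot_indep.

Definition quot_op (qs : seq quot_gvs) : quot_gvs := proj (mop (map qlift qs)).

Fact proj_mop xs : proj (mop xs) = quot_op (map proj xs).
Proof.
rewrite /quot_op; suff h s : proj (mop (s ++ xs)) =
    proj (mop (s ++ map qlift (map proj xs))) by exact: (h [::]).
elim: xs s => [|x xs IH] s //=; rewrite -cat_rcons IH cat_rcons.
apply/projP; rewrite -(multilinearB (@mop_multilinear _ A)).
by apply: ideal_mop; apply/projP; rewrite qliftK.
Qed.

Fact quot_op_nil : quot_op [::] = 0.
Proof. by rewrite /quot_op mop_nil proj0. Qed.

Fact map_qliftK qs : map proj (map qlift qs) = qs.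
Proof. by rewrite mapK //; exact: qliftK. Qed.

Fact quot_op_multilinear : multilinear quot_op.
Proof.
move=> s t a x y; rewrite -(map_qliftK s) -(map_qliftK t) -[x]qliftK -[y]qliftK.
rewrite -proj_linear -!map_cons -!map_cat -!proj_mop -proj_linear.
by rewrite ?map_cat ?map_cons mop_multilinear.
Qed.

Fact homs_qlift ds (qs : seq quot_gvs) : homs ds qs ->
  exists2 xs : seq A, homs ds xs & map proj xs = qs.
Proof.
elim=> [|d q ds' qs' [x hx <-] _ [xs hxs <-]]; first by exists [::] => //; left.
by exists (x :: xs) => //; right.
Qed.

Fact quot_op_degree : degree_one quot_op.
Proof.
move=> ds qs /homs_qlift[xs hxs <-]; rewrite -proj_mop.
by exists (mop xs) => //; exact: mop_degree.
Qed.

Fact quot_op_relation : Ainf_relation quot_op.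
Proof.
move=> n d q n0 /homs_qlift[xs hxs xsq].
have sxs : size xs == n by rewrite -(size_map proj) xsq size_tuple.
have := @mop_relation _ A n d (Tuple sxs) n0 hxs => /(congr1 proj).
rewrite proj0 proj_sum => rel; rewrite -[RHS]rel.
apply: eq_bigr => i _; rewrite proj_sum; apply: eq_bigr => j _.
by rewrite projZ proj_mop map_cat /= proj_mop !map_take !map_drop xsq.
Qed.

Definition quot_Ainf : Ainf k :=
  MkAinf quot_op_nil quot_op_multilinear quot_op_degree quot_op_relation.

End QuotAinf.

Section FreeAinf.
Variables (k : fieldType) (V : gvs k).

(* The free A_infinity-algebra on V, as a term model: formal expressions in  *)
(* elements of V, linear combinations and operations, identified when they   *)
(* take the same value in every A_infinity-algebra B under every degree zero *)
(* linear map V -> B.  Its universal property is free_Ainf_universal below.  *)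
Unset Elimination Schemes.
Inductive term :=
| TGen of V
| TLin of k & term & term
| TOp of seq term.
Set Elimination Schemes.

Fixpoint term_rect (P : term -> Prop) (hG : forall v, P (TGen v))
  (hL : forall a t u, P t -> P u -> P (TLin a t u))
  (hO : forall ts, List.Forall P ts -> P (TOp ts)) (t : term) : P t :=
  match t with
  | TGen v => hG v
  | TLin a t u => hL a t u (term_rect hG hL hO t) (term_rect hG hL hO u)
  | TOp ts => hO ts ((fix go ts : List.Forall P ts :=
      match ts with
      | [::] => List.Forall_nil P
      | t :: ts' => List.Forall_cons t (term_rect hG hL hO t) (go ts')
      end) ts)
  end.

Fixpoint teval (B : Ainf k) (f : V -> B) (t : term) : B :=
  match t with
  | TGen v => f v
  | TLin a t u => a *: teval f t + teval f u
  | TOp ts => mop (map (teval f) ts)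
  end.

Definition term_eq (t u : term) : Prop :=
  forall (B : Ainf k) (f : V -> B), linear f -> degree_zero f ->
    teval f t = teval f u.

HB.instance Definition _ := gen_eqMixin term.
HB.instance Definition _ := gen_choiceMixin term.

Definition term_eqb (t u : term) : bool := `[< term_eq t u >].

Fact term_eqb_equiv : equiv_class_of term_eqb.
Proof.
split=> [t|t u|u t v]; first exact/asboolP.
  by apply/asboolP/asboolP => h B f lf df; rewrite h.
by move=> /asboolP h1 /asboolP h2; apply/asboolP => B f lf df; rewrite h1 ?h2.
Qed.
Canonical term_eqb_rel := EquivRelPack term_eqb_equiv.

Definition free_car := {eq_quot term_eqb}.
HB.instance Definition _ := Choice.on free_car.

Definition cls (t : term) : free_car := \pi_free_car t.
Definition rep (q : free_car) : term := generic_quotient.repr q.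

Fact repK : cancel rep cls. Proof. exact: reprK. Qed.

Fact clsP t u : cls t = cls u <-> term_eq t u.
Proof.
rewrite /cls; split=> [/eqP|h]; first by rewrite piE => /asboolP.
by apply/eqP; rewrite piE; apply/asboolP.
Qed.

Fact rep_cls t : term_eq (rep (cls t)) t.
Proof. by apply/clsP; rewrite repK. Qed.

Definition fzero : free_car := cls (TGen 0).
Definition flin a p q : free_car := cls (TLin a (rep p) (rep q)).
Definition fadd := flin 1.
Definition fscale a p := flin a p fzero.
Definition fopp := fscale (-1).

Fact flinE a t u : flin a (cls t) (cls u) = cls (TLin a t u).
Proof. by apply/clsP => B f lf df /=; rewrite !rep_cls. Qed.

Fact lin0 (B : Ainf k) (f : V -> B) : linear f -> f 0 = 0.
Proof. by move=> lf; have := lf (-1) 0 0; rewrite scaler0 addr0 scaleN1r addNr. Qed.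

Fact faddA : associative fadd.
Proof.
move=> p q r; rewrite -[p]repK -[q]repK -[r]repK /fadd !flinE.
by apply/clsP => B f lf df /=; rewrite !scale1r addrA.
Qed.

Fact faddC : commutative fadd.
Proof.
move=> p q; rewrite -[p]repK -[q]repK /fadd !flinE.
by apply/clsP => B f lf df /=; rewrite !scale1r addrC.
Qed.

Fact fadd0 : left_id fzero fadd.
Proof.
move=> p; rewrite -[p]repK /fadd !flinE.
by apply/clsP => B f lf df /=; rewrite (lin0 lf) scaler0 add0r.
Qed.

Fact faddN : left_inverse fzero fopp fadd.
Proof.
move=> p; rewrite -[p]repK /fadd /fopp /fscale /fzero !flinE.
by apply/clsP => B f lf df /=; rewrite (lin0 lf) addr0 scale1r scaleN1r addNr.
Qed.

HB.instance Definition _ :=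
  GRing.isZmodule.Build free_car faddA faddC fadd0 faddN.

Fact fscaleA a b q : fscale a (fscale b q) = fscale (a * b) q.
Proof.
rewrite -[q]repK /fscale /fzero !flinE.
by apply/clsP => B f lf df /=; rewrite (lin0 lf) !addr0 scalerA.
Qed.

Fact fscale1 : left_id 1 fscale.
Proof.
move=> q; rewrite -[q]repK /fscale /fzero !flinE.
by apply/clsP => B f lf df /=; rewrite (lin0 lf) !addr0 scale1r.
Qed.

Fact fscaleDr : right_distributive fscale +%R.
Proof.
move=> a p q; rewrite -[p]repK -[q]repK.
rewrite -[X in fscale a X]/(fadd _ _) -[RHS]/(fadd _ _) /fscale /fadd /fzero !flinE.
by apply/clsP => B f lf df /=; rewrite (lin0 lf) !addr0 !scale1r scalerDr.
Qed.

Fact fscaleDl q : {morph fscale^~ q : a b / a + b}.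
Proof.
move=> a b; rewrite -[q]repK -[RHS]/(fadd _ _) /fscale /fadd /fzero !flinE.
by apply/clsP => B f lf df /=; rewrite (lin0 lf) !addr0 !scale1r scalerDl.
Qed.

HB.instance Definition _ := GRing.Zmodule_isLmodule.Build k free_car
  fscaleA fscale1 fscaleDr fscaleDl.

Fact flin_cls a t u : a *: cls t + cls u = cls (TLin a t u).
Proof.
rewrite -[LHS]/(fadd (fscale _ _) _) /fadd /fscale /fzero !flinE.
by apply/clsP => B f lf df /=; rewrite (lin0 lf) !addr0 !scale1r.
Qed.

Definition feval (B : Ainf k) (f : V -> B) (q : free_car) : B := teval f (rep q).

Fact feval_cls (B : Ainf k) (f : V -> B) t : linear f -> degree_zero f ->
  feval f (cls t) = teval f t.
Proof. by move=> lf df; exact: rep_cls. Qed.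

Fact feval_linear (B : Ainf k) (f : V -> B) : linear f -> degree_zero f ->
  linear (feval f).
Proof.
by move=> lf df a p q; rewrite -[p]repK -[q]repK flin_cls !feval_cls.
Qed.

Fact feval_ext p q : (forall (B : Ainf k) (f : V -> B),
  linear f -> degree_zero f -> feval f p = feval f q) -> p = q.
Proof. by move=> h; rewrite -[p]repK -[q]repK; apply/clsP. Qed.

Fact feval0 (B : Ainf k) (f : V -> B) : linear f -> degree_zero f ->
  feval f 0 = 0.
Proof. by move=> lf df; rewrite -[0]/fzero feval_cls //= lin0. Qed.

Fact feval_sum (B : Ainf k) (f : V -> B) (J : Type) (r : seq J) (P : pred J) F :
  linear f -> degree_zero f ->
  feval f (\sum_(i <- r | P i) F i) = \sum_(i <- r | P i) feval f (F i).
Proof.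
move=> lf df; apply: big_morph; last exact: feval0.
by move=> x y; rewrite -[x]scale1r feval_linear // !scale1r.
Qed.

Definition free_hom d (q : free_car) : Prop :=
  forall (B : Ainf k) (f : V -> B), linear f -> degree_zero f ->
    hom B d (feval f q).

Fact free_hom0 d : free_hom d 0.
Proof. by move=> B f lf df; rewrite feval0 //; exact: hom0. Qed.

Fact free_homP d a p q :
  free_hom d p -> free_hom d q -> free_hom d (a *: p + q).
Proof.
by move=> hp hq B f lf df; rewrite feval_linear //; apply: homP; auto.
Qed.

Definition free_op (qs : seq free_car) : free_car := cls (TOp (map rep qs)).

Fact feval_op (B : Ainf k) (f : V -> B) qs : linear f -> degree_zero f ->
  feval f (free_op qs) = mop (map (feval f) qs).
Proof. by move=> lf df; rewrite feval_cls //= -map_comp. Qed.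

Fact free_op_multilinear : multilinear free_op.
Proof.
move=> s t a x y; apply: feval_ext => B f lf df.
by rewrite feval_linear // !feval_op // !map_cat /= feval_linear // mop_multilinear.
Qed.

Fact free_op_nil : free_op [::] = 0.
Proof.
by apply: feval_ext => B f lf df; rewrite feval_op // mop_nil feval0.
Qed.

Definition pairs_hom (L : seq (int * free_car)) : Prop :=
  List.Forall (fun p => free_hom p.1 p.2) L.

Definition spanned (q : free_car) : Prop :=
  exists2 L, pairs_hom L & q = \sum_(p <- L) p.2.

Fact spanned_hom d q : free_hom d q -> spanned q.
Proof. by exists [:: (d, q)]; [by constructor; [|constructor] | rewrite big_seq1]. Qed.

Fact spanned_lin a p q : spanned p -> spanned q -> spanned (a *: p + q).
Proof.
move=> [L hL ->] [M hM ->].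
exists (map (fun u => (u.1, a *: u.2)) L ++ M); last first.
  by rewrite big_cat big_map scaler_sumr.
elim: hL => [|u L' hu _ IH] //=; constructor=> //=.
by rewrite -[a *: _]addr0; apply: free_homP => //; exact: free_hom0.
Qed.

Fact spanned_op qs : List.Forall spanned qs -> spanned (free_op qs).
Proof.
suff h ps ds : List.Forall2 free_hom ds ps -> List.Forall spanned qs ->
    spanned (free_op (ps ++ qs)).
  by apply: (h [::] [::]); constructor.
move=> + hqs; elim: hqs ps ds => {qs} [|q qs [L hL ->] _ IH] ps ds hps.
  rewrite cats0; apply: (@spanned_hom (tdeg ds + 1)) => B f lf df.
  rewrite feval_op //; apply: mop_degree.
  by elim: hps => [|d p ds' ps' hp _ h]; constructor => //; exact: hp.
elim: hL => [|[d u] L' /= hu _ IHL].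
  rewrite big_nil (multilinear0 free_op_multilinear).
  exact: (spanned_hom (free_hom0 0)).
rewrite big_cons (multilinearD free_op_multilinear) -[free_op _]scale1r.
apply: spanned_lin => //; rewrite -cat_rcons; apply: (IH _ (rcons ds d)).
rewrite -!cats1; apply: List.Forall2_app => //; by constructor; [|constructor].
Qed.

Definition gen (v : V) : free_car := cls (TGen v).

Fact gen_linear : linear gen.
Proof.
by move=> a v w; rewrite flin_cls; apply/clsP => B f lf df /=; rewrite lf.
Qed.

Fact gen_degree d v : hom V d v -> free_hom d (gen v).
Proof. by move=> hv B f lf df; rewrite feval_cls //=; exact: df. Qed.

Fact cls_op ts : cls (TOp ts) = free_op (map cls ts).
Proof.
apply: feval_ext => B f lf df; rewrite feval_op // feval_cls //= -map_comp.
by congr mop; apply: eq_map => t /=; rewrite feval_cls.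
Qed.

Fact spanned_cls t : spanned (cls t).
Proof.
elim/term_rect: t => [v|a t u ht hu|ts hts].
- have [D [y [_ hy ->]]] := hom_span v.
  rewrite -/(gen _); exists [seq (d, gen (y d)) | d <- D].
    by elim: D => [|d D IH] /=; constructor=> //=; exact: gen_degree.
  rewrite big_map /=; apply: (big_morph gen) => [x z|].
    by rewrite -[x]scale1r gen_linear !scale1r.
  by [].
- by rewrite -flin_cls; exact: spanned_lin.
rewrite cls_op; apply: spanned_op.
by elim: hts => [|t ts' ht _ IH]; constructor.
Qed.

Fact free_span (q : free_car) : exists (D : seq int) (y : int -> free_car),
  [/\ uniq D, forall d, free_hom d (y d) & q = \sum_(d <- D) y d].
Proof.
have [L hL qE] := spanned_cls (rep q).
have [D [y [uD hy LE]]] := span_pairs free_hom0 free_homP hL.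
by exists D, y; split=> //; rewrite -[q]repK qE.
Qed.

Fact free_indep (D : seq int) (y : int -> free_car) :
  uniq D -> (forall d, free_hom d (y d)) -> \sum_(d <- D) y d = 0 ->
  forall d, d \in D -> y d = 0.
Proof.
move=> uD hy y0 d dD; apply: feval_ext => B f lf df; rewrite feval0 //.
apply: (@hom_indep _ B D (fun e => feval f (y e))) => // [e|].
  exact: hy.
by rewrite -feval_sum // y0 feval0.
Qed.

Definition free_gvs : gvs k := Gvs free_hom0 free_homP free_span free_indep.

Fact homs_feval (B : Ainf k) (f : V -> B) ds (qs : seq free_gvs) :
  linear f -> degree_zero f -> homs ds qs -> homs ds (map (feval f) qs).
Proof.
move=> lf df; elim=> [|d p ds' ps' hp _ h] /=; constructor => //.
exact: hp.
Qed.

Fact free_op_degree : @degree_one k free_gvs free_gvs free_op.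
Proof.
move=> ds qs h B f lf df; rewrite feval_op //; apply: mop_degree.
exact: homs_feval.
Qed.

Fact free_op_relation : @Ainf_relation k free_gvs free_op.
Proof.
move=> n d q n0 h; apply: feval_ext => B f lf df; rewrite feval0 //.
have hf : homs d (map_tuple (feval f) q) by exact: homs_feval.
rewrite -[RHS](@mop_relation _ B n d (map_tuple (feval f) q) n0 hf).
rewrite feval_sum //; apply: eq_bigr => i _.
rewrite feval_sum //; apply: eq_bigr => j _.
rewrite -[_ *: free_op _]addr0 feval_linear // feval0 // addr0.
by rewrite !feval_op // map_cat /= feval_op // !map_take !map_drop.
Qed.

Definition free_Ainf : Ainf k :=
  @MkAinf k free_gvs free_op free_op_nil free_op_multilinear free_op_degree
    free_op_relation.

Lemma free_Ainf_universal (B : Ainf k) (f : V -> B) :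
  linear f -> degree_zero f ->
  exists! F : free_Ainf -> B, Ainf_morphism F /\ (forall v, F (gen v) = f v).
Proof.
move=> lf df; exists (feval f); split.
  split=> [|v]; last by rewrite feval_cls.
  split=> [|d q hq|qs]; [exact: feval_linear | exact: hq | exact: feval_op].
move=> G [[lG _ mG] Gg]; apply/funext => q; rewrite -[q]repK feval_cls //.
elim/term_rect: (rep q) => [v|a t u ht hu|ts hts] /=; first by rewrite -Gg.
  by rewrite ht hu -flin_cls lG.
rewrite cls_op mG -map_comp; congr mop.
by elim: hts => [|t ts' /= -> _ ->].
Qed.

End FreeAinf.

Section DirectSum.
Variables (k : fieldType) (V W : gvs k).

Definition dsum_hom d (x : V * W) : Prop := hom V d x.1 /\ hom W d x.2.

Fact dsum_hom0 d : dsum_hom d 0.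
Proof. by split; exact: hom0. Qed.

Fact dsum_homP d a x y : dsum_hom d x -> dsum_hom d y -> dsum_hom d (a *: x + y).
Proof. by move=> [x1 x2] [y1 y2]; split; exact: homP. Qed.

Fact dsum_sum (r : seq int) (F : int -> V * W) :
  \sum_(i <- r) F i = (\sum_(i <- r) (F i).1, \sum_(i <- r) (F i).2).
Proof.
elim: r => [|d r IH]; first by rewrite !big_nil.
by rewrite !big_cons IH; case: (F d).
Qed.

Fact dsum_span (x : V * W) : exists (D : seq int) (y : int -> V * W),
  [/\ uniq D, forall d, dsum_hom d (y d) & x = \sum_(d <- D) y d].
Proof.
case: x => v w; have [D [y [_ hy vE]]] := hom_span v.
have [E [z [_ hz wE]]] := hom_span w.
pose L : seq (int * (V * W)%type) :=
  [seq (d, (y d, 0)) | d <- D] ++ [seq (d, (0, z d)) | d <- E].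
have hL : List.Forall (fun p => dsum_hom p.1 p.2) L.
  apply/List.Forall_app; split.
    by elim: (D) => [|d D' IH] /=; constructor=> //; split=> //; exact: hom0.
  by elim: (E) => [|d D' IH] /=; constructor=> //; split=> //; exact: hom0.
have [F [u [uF hu LE]]] := span_pairs dsum_hom0 dsum_homP hL.
exists F, u; split=> //; rewrite -LE big_cat !big_map /= !dsum_sum /=.
by rewrite [X in (_, X) + _]big1 // [X in _ + (X, _)]big1 // -vE -wE;
  congr pair; rewrite ?addr0 ?add0r.
Qed.

Fact dsum_indep (D : seq int) (y : int -> V * W) :
  uniq D -> (forall d, dsum_hom d (y d)) -> \sum_(d <- D) y d = 0 ->
  forall d, d \in D -> y d = 0.
Proof.
move=> uD hy; rewrite dsum_sum => -[y1 y2] d dD.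
rewrite [y d]surjective_pairing.
rewrite (@hom_indep _ V D (fun e => (y e).1)) => //; last by move=> e; case: (hy e).
by rewrite (@hom_indep _ W D (fun e => (y e).2)) => // e; case: (hy e).
Qed.

Definition dsum : gvs k := Gvs dsum_hom0 dsum_homP dsum_span dsum_indep.

End DirectSum.

(* mu_n applied to the shuffle product Sh(x_1..x_i | x_{i+1}..x_n). *)
Definition mop_Sh (k : fieldType) (A : Ainf k) i n (d : n.-tuple int)
    (x : n.-tuple A) : A :=
  \sum_(s : 'S_n | unshuffle i (s^-1)%g) (-1) ^ koszul s d *: mop (ptup s x).

Section Envelopes.
Variable k : fieldType.

Definition sym_mop (A : Ainf k) n (d : n.-tuple int) (x : n.-tuple A) : A :=
  \sum_(s : 'S_n) (-1) ^ koszul s d *: mop (ptup s x).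

Section OchaEnvelope.
Variable H : ocha k.

Let Hc : gvs k := ocha_closed H.
Let Ho : gvs k := ocha_open H.
Let F : Ainf k := free_Ainf (dsum Hc Ho).
Let inc_c (c : Hc) : F := gen (V := dsum Hc Ho) (c, 0).
Let inc_o (o : Ho) : F := gen (V := dsum Hc Ho) (0, o).

(* A relation lhs = rhs is represented by the element lhs - rhs. *)
Inductive Uinf_relation : F -> Prop :=
| Uinf_relation_open p q (d : p.-tuple int) (c : p.-tuple Hc)
    (e : q.-tuple int) (o : q.-tuple Ho) of (0 < q)%N & homs d c & homs e o :
    Uinf_relation
      (\sum_(s : 'S_p) (-1) ^ koszul s d *:
         mop_Sh p (cat_tuple (ptup s d) e)
           (cat_tuple (map_tuple inc_c (ptup s c)) (map_tuple inc_o o))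
       - inc_o (nop c o))
| Uinf_relation_closed p (d : p.-tuple int) (c : p.-tuple Hc)
    of (0 < p)%N & homs d c :
    Uinf_relation
      (sym_mop d (map_tuple inc_c c)
       - (inc_c (lop c) + inc_o (nop c [::]))).

Definition Uinf : Ainf k := quot_Ainf (ideal_gen Uinf_relation).

Definition Uinf_gen (x : dsum Hc Ho) : Uinf :=
  proj (ideal_gen Uinf_relation) (gen x).

Definition open_ideal : Ainf_ideal Uinf :=
  ideal_gen (fun x => exists o : Ho, x = Uinf_gen (0, o)).

End OchaEnvelope.

Section LinfEnvelope.
Variable L : Linf k.

Inductive Linf_Uinf_relation : free_Ainf L -> Prop :=
| Linf_Uinf_relation_intro p (d : p.-tuple int) (c : p.-tuple L)
    of (0 < p)%N & homs d c :
    Linf_Uinf_relation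
      (sym_mop d (map_tuple (fun x => gen x : free_Ainf L) c)
       - (gen (lop c) : free_Ainf L)).

Definition Linf_Uinf : Ainf k := quot_Ainf (ideal_gen Linf_Uinf_relation).

Definition Linf_Uinf_gen (c : L) : Linf_Uinf :=
  proj (ideal_gen Linf_Uinf_relation) (gen c).

End LinfEnvelope.

End Envelopes.

(* Main.v *)
Require Import Defs.
From mathcomp Require Import all_boot all_order all_fingroup all_algebra.
From mathcomp Require Import boolp.

Set Implicit Arguments.
Unset Strict Implicit.
Unset Printing Implicit Defensive.

Import GRing.Theory.
Local Open Scope ring_scope.

(* The map [pi] kills the open generators.  Its kernel is the ideal they      *)
(* generate because, modulo that ideal, the relations of the enveloping       *)
(* algebra of the pair become those of the closed one, which gives a morphism *)
(* [rho] from the latter to the quotient such that [rho \o pi] is the         *)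
(* canonical projection.                                                      *)

(** Send a generator [(c, o)] to the class of [c]. An open relation becomes 0 = 0, because q > 0
    puts a zero into every word. A closed relation loses its n_{p,0} term and becomes the Lada-Markl
    relation ([pfree_relation]). So [Uinf_pi] exists; its image contains all generators, and it
    kills the open ones, hence all of [open_ideal].

    For the reverse inclusion, the n_{p,0} terms obstruct sending [c] back to [(c, 0)] in [Uinf H]
    itself, but they vanish modulo [open_ideal] ([rfree_relation]). The resulting [Uinf_rho]
    recovers the class of x modulo [open_ideal] from [Uinf_pi x] ([Uinf_rho_pi]), so the kernel is
    no larger than [open_ideal]. Maps are built and compared on free algebras and descend by
    [quot_lift]. *)

Section Morphisms.
Variable k : fieldType.

(** * Kernels of morphisms and descent to quotients *)

Section OneMorphism.
Variables (A B : Ainf k) (f : A -> B).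
Hypothesis fM : Ainf_morphism f.

Lemma Ainf_morphism0 : f 0 = 0.
Proof.
have := Ainf_morphism_linear fM (-1) 0 0.
by rewrite scaler0 addr0 scaleN1r addNr.
Qed.

Lemma Ainf_morphismD x y : f (x + y) = f x + f y.
Proof. by have := Ainf_morphism_linear fM 1 x y; rewrite !scale1r. Qed.

Lemma Ainf_morphismZ a x : f (a *: x) = a *: f x.
Proof.
by have := Ainf_morphism_linear fM a x 0; rewrite Ainf_morphism0 !addr0.
Qed.

Lemma Ainf_morphismB x y : f (x - y) = f x - f y.
Proof. by rewrite -scaleN1r Ainf_morphismD Ainf_morphismZ scaleN1r. Qed.

Lemma Ainf_morphism_sum (J : Type) (r : seq J) (P : pred J) (F : J -> A) :
  f (\sum_(i <- r | P i) F i) = \sum_(i <- r | P i) f (F i).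
Proof. exact: (big_morph f Ainf_morphismD Ainf_morphism0). Qed.

Lemma map_ptup (T T' : Type) (g : T -> T') n (s : 'S_n) (x : n.-tuple T) :
  map_tuple g (ptup s x) = ptup s (map_tuple g x).
Proof. by apply: eq_from_tnth => i; rewrite !(tnth_map, tnth_mktuple). Qed.

Lemma Ainf_morphism_mop_ptup n (s : 'S_n) (x : n.-tuple A) :
  f (mop (ptup s x)) = mop (ptup s (map_tuple f x)).
Proof. by rewrite (Ainf_morphism_mop fM) -map_ptup. Qed.

Lemma Ainf_morphism_sym_mop n (d : n.-tuple int) (x : n.-tuple A) :
  f (sym_mop d x) = sym_mop d (map_tuple f x).
Proof.
rewrite Ainf_morphism_sum; apply: eq_bigr => s _.
by rewrite Ainf_morphismZ Ainf_morphism_mop_ptup.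
Qed.

Lemma Ainf_morphism_mop_Sh i n (d : n.-tuple int) (x : n.-tuple A) :
  f (mop_Sh i d x) = mop_Sh i d (map_tuple f x).
Proof.
rewrite Ainf_morphism_sum; apply: eq_bigr => s _.
by rewrite Ainf_morphismZ Ainf_morphism_mop_ptup.
Qed.

Let ker x := f x = 0.

Fact ker_setP a x y : ker x -> ker y -> ker (a *: x + y).
Proof.
by rewrite /ker Ainf_morphismD Ainf_morphismZ => -> ->; rewrite scaler0 addr0.
Qed.

Fact ker_graded (D : seq int) (y : int -> A) :
  uniq D -> (forall d, Defs.hom A d (y d)) -> ker (\sum_(d <- D) y d) ->
  forall d, d \in D -> ker (y d).
Proof.
move=> uD hy; rewrite /ker Ainf_morphism_sum => y0.
apply: (@hom_indep _ B D (fun d => f (y d))) => // d.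
exact: (Ainf_morphism_degree fM).
Qed.

Fact ker_mop s x t : ker x -> ker (mop (s ++ x :: t)).
Proof.
rewrite /ker (Ainf_morphism_mop fM) map_cat /= => ->.
exact: (multilinear0 (@mop_multilinear _ B)).
Qed.

(** An ideal containing whatever generators [f] kills, hence the ideal they generate. This serves
    both for descent to quotients and for the easy half of [Uinf_pi_ker]. *)
Definition ker_ideal : Ainf_ideal A :=
  MkIdeal Ainf_morphism0 ker_setP ker_graded ker_mop.

Variables (S : A -> Prop) (fS : forall x, S x -> f x = 0).

Definition quot_lift (q : quot_Ainf (ideal_gen S)) : B := f (qlift q).

(** The chosen representative differs from [x] by an element of the generated ideal, which lies
    inside [ker_ideal]. *)
Lemma quot_liftE x : quot_lift (proj (ideal_gen S) x) = f x.
Proof.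
apply/subr0_eq; rewrite -Ainf_morphismB.
have: ideal_gen S (qlift (proj (ideal_gen S) x) - x).
  by apply/projP; rewrite qliftK.
by move/(_ ker_ideal fS).
Qed.

Lemma quot_lift_morphism : Ainf_morphism quot_lift.
Proof.
split=> [a p q|d q [x hx <-]|qs].
- rewrite -[p]qliftK -[q]qliftK -[_ *: _ + _]proj_linear !quot_liftE.
  exact: (Ainf_morphism_linear fM).
- by rewrite quot_liftE; exact: (Ainf_morphism_degree fM).
- rewrite -[mop qs]/(proj _ (mop (map (@qlift _ _ _) qs))) quot_liftE.
  by rewrite (Ainf_morphism_mop fM) -map_comp.
Qed.

End OneMorphism.

Lemma ideal_gen_incl (A : Ainf k) (S : A -> Prop) x : S x -> ideal_gen S x.
Proof. by move=> Sx I; apply. Qed.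

Lemma proj_morphism (A : Ainf k) (I : Ainf_ideal A) :
  Ainf_morphism (proj I : A -> quot_Ainf I).
Proof.
split=> [|d x hx|xs]; [exact: proj_linear | by exists x | exact: proj_mop].
Qed.

Lemma comp_morphism (A B C : Ainf k) (g : B -> C) (f : A -> B) :
  Ainf_morphism g -> Ainf_morphism f -> Ainf_morphism (g \o f).
Proof.
move=> [lg dg mg] [lf df mf]; split=> [a x y|d x hx|xs] /=.
- by rewrite lf lg.
- exact/dg/df.
- by rewrite mf mg map_comp.
Qed.

Lemma incl_morphism (A : Ainf k) (I : Ainf_ideal A) :
  Ainf_morphism (A := ideal_Ainf I) (B := A) (@incl k A I).
Proof. by split. Qed.

Lemma feval_morphism (V : gvs k) (B : Ainf k) (f : V -> B) :
  linear f -> degree_zero f ->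
  Ainf_morphism (A := free_Ainf V) (feval f).
Proof.
by move=> lf df; split=> [|d q hq|qs];
  [exact: feval_linear | exact: hq | exact: feval_op].
Qed.

(** Both are the unique extension of one linear map on generators. *)
Lemma free_morphism_ext (V : gvs k) (B : Ainf k) (F G : free_Ainf V -> B) :
  Ainf_morphism F -> Ainf_morphism G ->
  (forall v, F (gen v) = G (gen v)) -> F =1 G.
Proof.
move=> FM GM FG.
have lG : linear (fun v => G (gen v)).
  by move=> a v w; rewrite gen_linear (Ainf_morphism_linear GM).
have dG : degree_zero (fun v => G (gen v)).
  by move=> d v hv; apply: (Ainf_morphism_degree GM); exact: gen_degree.
have [E [_ uE]] := free_Ainf_universal lG dG.
by move=> q; rewrite -(uE F) // -(uE G).
Qed.

End Morphisms.

(** * Generators of the two envelopes and the relations they satisfy *)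

Section Extension.
Variables (k : fieldType) (H : ocha k).
Let L := ocha_closed H.
Let V := dsum L (ocha_open H).

Lemma Linf_Uinf_gen_linear : linear (@Linf_Uinf_gen k L).
Proof. by move=> a c c'; rewrite /Linf_Uinf_gen gen_linear proj_linear. Qed.

Lemma Linf_Uinf_gen_degree : degree_zero (@Linf_Uinf_gen k L).
Proof. by move=> d c hc; exists (gen c) => //; exact: gen_degree. Qed.

Lemma Uinf_gen_linear : linear (@Uinf_gen k H).
Proof. by move=> a x y; rewrite /Uinf_gen gen_linear proj_linear. Qed.

Lemma Uinf_gen_degree : degree_zero (@Uinf_gen k H).
Proof. by move=> d x hx; exists (gen x) => //; exact: gen_degree. Qed.

Lemma Linf_Uinf_sym_mop p (d : p.-tuple int) (c : p.-tuple L) :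
  (0 < p)%N -> homs d c ->
  sym_mop d (map_tuple (@Linf_Uinf_gen k L) c) = Linf_Uinf_gen (lop c).
Proof.
move=> p0 hc; apply/subr0_eq.
pose pr := proj (ideal_gen (@Linf_Uinf_relation k L)).
have prM := proj_morphism (ideal_gen (@Linf_Uinf_relation k L)).
rewrite -[Linf_Uinf_gen _]/(pr _).
rewrite (_ : map_tuple _ c = map_tuple pr (map_tuple (@gen k L) c)); last first.
  by apply: eq_from_tnth => i; rewrite !tnth_map.
rewrite -(Ainf_morphism_sym_mop prM) -(Ainf_morphismB prM).
by apply/proj_eq0/ideal_gen_incl; exact: Linf_Uinf_relation_intro.
Qed.

Lemma Uinf_sym_mop p (d : p.-tuple int) (c : p.-tuple L) :
  (0 < p)%N -> homs d c ->
  sym_mop d (map_tuple (fun c => @Uinf_gen k H (c, 0)) c) =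
  Uinf_gen (lop c, 0) + Uinf_gen (0, nop c [::]).
Proof.
move=> p0 hc; apply/subr0_eq.
pose pr := proj (ideal_gen (@Uinf_relation k H)).
have prM := proj_morphism (ideal_gen (@Uinf_relation k H)).
rewrite -[Uinf_gen _]/(pr _) -[Uinf_gen (0, _)]/(pr _) -(Ainf_morphismD prM).
rewrite (_ : map_tuple _ c =
  map_tuple pr (map_tuple (fun c => @gen k V (c, 0)) c)); last first.
  by apply: eq_from_tnth => i; rewrite !tnth_map.
rewrite -(Ainf_morphism_sym_mop prM) -(Ainf_morphismB prM).
by apply/proj_eq0/ideal_gen_incl; exact: Uinf_relation_closed.
Qed.

(** * The projection onto the closed envelope *)

Let pgen (x : V) : Linf_Uinf L := Linf_Uinf_gen x.1.

Fact pgen_linear : linear pgen.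
Proof. by move=> a x y; rewrite /pgen /= Linf_Uinf_gen_linear. Qed.

Fact pgen_degree : degree_zero pgen.
Proof. by move=> d x [hx _]; exact: Linf_Uinf_gen_degree. Qed.

Let pfree := feval pgen.

Fact pfree_morphism : Ainf_morphism (A := free_Ainf V) pfree.
Proof. exact: feval_morphism pgen_linear pgen_degree. Qed.

Fact pfree_gen x : pfree (gen x) = Linf_Uinf_gen x.1.
Proof. exact: feval_cls pgen_linear pgen_degree. Qed.

Fact Linf_Uinf_gen0 : Linf_Uinf_gen (0 : L) = 0.
Proof. exact: lin0 Linf_Uinf_gen_linear. Qed.

Lemma mop_ptup0 (A : Ainf k) n (s : 'S_n) (x : n.-tuple A) i :
  tnth x i = 0 -> mop (ptup s x) = 0.
Proof.
move=> xi0; have /path.splitPr[t u] : 0 \in (ptup s x : seq A).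
  apply/tnthP; exists ((s^-1)%g i).
  by rewrite tnth_mktuple permKV.
exact: (multilinear0 (@mop_multilinear _ A)).
Qed.

Fact pfree_relation x : Uinf_relation x -> pfree x = 0.
Proof.
have fM := pfree_morphism.
case=> [p q d c e o q0 hc ho|p d c p0 hc].
  rewrite (Ainf_morphismB fM) pfree_gen Linf_Uinf_gen0 subr0.
  rewrite (Ainf_morphism_sum fM) big1 // => s _.
  rewrite (Ainf_morphismZ fM) (Ainf_morphism_mop_Sh fM).
  rewrite /mop_Sh big1 ?scaler0 // => t _.
  (* Position p holds the first open argument, whose image is zero. *)
  rewrite (@mop_ptup0 _ _ _ _ (rshift p (Ordinal q0))) ?scaler0 //.
  rewrite tnth_map tnth_rshift tnth_map pfree_gen; exact: Linf_Uinf_gen0.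
rewrite (Ainf_morphismB fM) (Ainf_morphism_sym_mop fM) (Ainf_morphismD fM).
rewrite !pfree_gen /= Linf_Uinf_gen0 addr0.
rewrite [X in sym_mop d X](_ : _ = map_tuple (@Linf_Uinf_gen k L) c).
  by rewrite Linf_Uinf_sym_mop ?subrr.
by apply: eq_from_tnth => i; rewrite !tnth_map pfree_gen.
Qed.

Definition Uinf_pi : Uinf H -> Linf_Uinf L :=
  @quot_lift k (free_Ainf V) (Linf_Uinf L) pfree (@Uinf_relation k H).

Lemma Uinf_pi_morphism : Ainf_morphism Uinf_pi.
Proof. exact: (quot_lift_morphism (A := free_Ainf V) (B := Linf_Uinf L)
  pfree_morphism pfree_relation). Qed.

Lemma Uinf_pi_gen x : Uinf_pi (Uinf_gen x) = Linf_Uinf_gen x.1.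
Proof.
by rewrite [LHS](quot_liftE pfree_morphism pfree_relation) pfree_gen.
Qed.

(** A preimage comes from a representative of [z] in the free algebra, where [c] may go to [(c, 0)]
    without any relation to respect. *)
Lemma Uinf_pi_surj z : exists x, Uinf_pi x = z.
Proof.
pose g c := @Uinf_gen k H (c, 0).
have lg : linear g.
  move=> a c c'; rewrite -Uinf_gen_linear /g.
  by congr (Uinf_gen (_, _)); rewrite /= scaler0 addr0.
have dg : degree_zero g.
  by move=> d c hc; apply: Uinf_gen_degree; split=> //; exact: hom0.
exists (feval g (qlift z)); rewrite -[RHS]qliftK.
apply: (free_morphism_ext (F := Uinf_pi \o feval g)) => [||c].
- exact: comp_morphism Uinf_pi_morphism (feval_morphism lg dg).
- exact: proj_morphism.
- by rewrite /= feval_cls // Uinf_pi_gen.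
Qed.

(** * The map back, modulo the open ideal, and the kernel *)

Let Q := quot_Ainf (open_ideal H).
Let rgen (c : L) : Q := proj (open_ideal H) (Uinf_gen (c, 0)).

Fact rgenE c o : proj (open_ideal H) (Uinf_gen (c, o)) = rgen c.
Proof.
apply/projP; rewrite (_ : _ - _ = Uinf_gen (0, o)).
  by apply: ideal_gen_incl; exists o.
apply/eqP; rewrite subr_eq -[Uinf_gen (0, o)]scale1r -Uinf_gen_linear; apply/eqP.
by congr (Uinf_gen (_, _)); rewrite /= ?scale1r ?scaler0 ?add0r ?addr0.
Qed.

Fact rgen_linear : linear rgen.
Proof.
move=> a c c'; rewrite /rgen -proj_linear -Uinf_gen_linear.
by congr (proj _ (Uinf_gen (_, _))); rewrite /= scaler0 addr0.
Qed.

Fact rgen_degree : degree_zero rgen.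
Proof.
move=> d c hc; exists (Uinf_gen (c, 0)) => //.
by apply: Uinf_gen_degree; split=> //; exact: hom0.
Qed.

Let rfree := feval rgen.

Fact rfree_morphism : Ainf_morphism (A := free_Ainf L) rfree.
Proof. exact: feval_morphism rgen_linear rgen_degree. Qed.

Fact rfree_gen c : rfree (gen c) = rgen c.
Proof. exact: feval_cls rgen_linear rgen_degree. Qed.

(** This is the closed relation of [Uinf H] read in [Q], where its n_{p,0} term, an open generator,
    is zero. *)
Fact rfree_relation x : Linf_Uinf_relation x -> rfree x = 0.
Proof.
have fM := rfree_morphism; have prM := proj_morphism (open_ideal H).
case=> p d c p0 hc.
rewrite (Ainf_morphismB fM) (Ainf_morphism_sym_mop fM) rfree_gen.
have /(congr1 (proj (open_ideal H))) := Uinf_sym_mop p0 hc.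
rewrite (Ainf_morphismD prM) !rgenE (lin0 rgen_linear) addr0 => <-.
rewrite (Ainf_morphism_sym_mop prM).
rewrite [X in sym_mop d X - _](_ : _ = map_tuple rgen c).
  rewrite [X in _ - sym_mop d X](_ : _ = map_tuple rgen c) ?subrr //.
  by apply: eq_from_tnth => i; rewrite !tnth_map.
by apply: eq_from_tnth => i; rewrite !tnth_map rfree_gen.
Qed.

Definition Uinf_rho : Linf_Uinf L -> Q :=
  @quot_lift k (free_Ainf L) Q rfree (@Linf_Uinf_relation k L).

Lemma Uinf_rho_morphism : Ainf_morphism Uinf_rho.
Proof. exact: (quot_lift_morphism (A := free_Ainf L) (B := Q)
  rfree_morphism rfree_relation). Qed.

Lemma Uinf_rho_gen c : Uinf_rho (Linf_Uinf_gen c) = rgen c.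
Proof.
by rewrite [LHS](quot_liftE rfree_morphism rfree_relation) rfree_gen.
Qed.

Lemma Uinf_rho_pi x : Uinf_rho (Uinf_pi x) = proj (open_ideal H) x.
Proof.
(* Lifting [x] to the free algebra reduces the identity to a check on generators. *)
rewrite -[x]qliftK; set pr := proj (ideal_gen _).
have prM := proj_morphism (ideal_gen (@Uinf_relation k H)).
apply: (free_morphism_ext (F := (Uinf_rho \o Uinf_pi) \o pr)
  (G := proj (open_ideal H) \o pr)) => [||[c o]].
- apply: comp_morphism prM.
  exact: comp_morphism Uinf_rho_morphism Uinf_pi_morphism.
- exact: comp_morphism (proj_morphism _) prM.
- by rewrite /= -[pr _]/(Uinf_gen _) Uinf_pi_gen Uinf_rho_gen rgenE.
Qed.

Lemma Uinf_pi_ker x : Uinf_pi x = 0 <-> open_ideal H x.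
Proof.
split=> [px0|].
  by apply/proj_eq0; rewrite -Uinf_rho_pi px0 (Ainf_morphism0 Uinf_rho_morphism).
(* The generated ideal lies in every ideal containing the open generators, in particular in the
   kernel. *)
move/(_ (ker_ideal Uinf_pi_morphism)); apply=> _ [o ->].
by rewrite /= Uinf_pi_gen; exact: Linf_Uinf_gen0.
Qed.

End Extension.

Theorem theorem3 (k : fieldType) (char0 : [pchar k] =i pred0) (H : ocha k) :
  exists pi : Uinf H -> Linf_Uinf (ocha_closed H),
    short_exact (A := ideal_Ainf (open_ideal H)) (E := Uinf H)
                (B := Linf_Uinf (ocha_closed H))
      (@incl k (Uinf H) (open_ideal H)) pi
    /\ forall (c : ocha_closed H) (o : ocha_open H),
         pi (Uinf_gen (c, o)) = Linf_Uinf_gen c.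
Proof.
exists (@Uinf_pi k H); split; last by move=> c o; rewrite Uinf_pi_gen.
split.
- exact: incl_morphism.
- exact: Uinf_pi_morphism.
- exact: val_inj.
- move=> x; rewrite Uinf_pi_ker; split=> [Ix|[y <-]]; last exact: incl_ideal.
  have xI : x \in ideal_pred (open_ideal H) by exact/asboolP.
  by exists (Sub x xI); rewrite /incl SubK.
- exact: Uinf_pi_surj.
Qed.
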